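(* (i) Let $x:T^n=\mathbb{R}^n/\Lambda_n\to\mathbb{S}^{2N-1}$ be a homogeneous isometric immersion, where $T^n$ carries the metric $\frac{4\pi^2}{n}(du_1^2+\dots+du_n^2)$ and $N$ is half the dimension of the eigenspace of $T^n$ for the eigenvalue $n$ (equivalently $2N$ is the number of vectors of length $1$ in $\Lambda_n^*$). Let $Q$ be the Gram matrix of $\Lambda_n^*$ with respect to a chosen basis and let $Y\subset\mathbb{Z}^n$ be the set of coordinate vectors in this basis of the vectors of $\Lambda_n^*$ of length $1$ (one chosen from each pair $\pm\xi$). If $x$ is minimal and linearly full, then $\frac1nQ^{-1}$ lies in the relative interior of $C_Y$ and is a critical point of the determinant function restricted to $C_Y$. (ii) Conversely, let $X\subset\mathbb{Z}^n$ be a finite set with $C_X\cap\Sigma_+\ne\varnothing$. If $P$ lies in the relative interior of $C_X$ and is a critical point of the determinant function restricted to $C_X$, then the flat torus $\mathbb{R}^n/\Lambda_n$, where $\Lambda_n$ is a lattice with Gram matrix $nP$, equipped with the metric $\frac{4\pi^2}{n}(du_1^2+\dots+du_n^2)$, admits an isometric minimal immersion in some $\mathbb{S}^{2N-1}$.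
   Context: $S(n)$ is the space of real symmetric $n\times n$ matrices and $\Sigma_+\subset S(n)$ the set of positive definite matrices. Vectors in $\mathbb{Z}^n$ are row vectors. For $X\subset\mathbb{Z}^n$, $C_X\subset S(n)$ is the convex hull of $\{A^tA:A\in X\}$; relative interior is taken in the affine hull of $C_X$, and a critical point of $\det$ on $C_X$ at a relative interior point means that the derivative of $\det$ vanishes in all directions tangent to the affine hull. The dual lattice is $\Lambda_n^*=\{\xi:\langle\xi,v\rangle\in\mathbb{Z}\ \forall v\in\Lambda_n\}$. An immersion $x$ of $\mathbb{R}^n/\Lambda_n$ into a sphere is called homogeneous here if, up to an orthogonal transformation, it has the form $x(u)=(c_1e^{2\pi i\langle\xi_1,u\rangle},\dots,c_Ne^{2\pi i\langle\xi_N,u\rangle})$ with $\xi_j\in\Lambda_n^*$ and $c_j\ge0$. Linearly full in $\mathbb{S}^{2N-1}$ means the image is not contained in a proper linear subspace of $\mathbb{R}^{2N}$. *)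

(* Defs.v *)
From HB Require Import structures.
From mathcomp Require Import all_boot all_order all_algebra.
From mathcomp Require Import all_classical all_reals all_analysis.

Set Implicit Arguments.
Unset Strict Implicit.
Unset Printing Implicit Defensive.

Import Order.TTheory GRing.Theory Num.Theory.
Import numFieldNormedType.Exports.

Local Open Scope classical_set_scope.
Local Open Scope ring_scope.

(* The library norm on 'rV[R]_n is the sup norm; lengths and angles use the
   Euclidean structure below. *)
Definition dotv (R : realType) (n : nat) (u v : 'rV[R]_n) : R :=
  (u *m v^T) 0 0.

Definition enorm (R : realType) (n : nat) (u : 'rV[R]_n) : R :=
  Num.sqrt (dotv u u).

Definition zrow (R : realType) (n : nat) (a : 'rV[int]_n) : 'rV[R]_n :=
  map_mx intr a.

(* The rows of B form a Z-basis of the full-rank lattice L. *)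
Definition lattice_basis (R : realType) (n : nat) (B : 'M[R]_n)
    (L : set 'rV[R]_n) : Prop :=
  B \in unitmx /\ L = [set zrow R a *m B | a in [set: 'rV[int]_n]].

Definition is_lattice (R : realType) (n : nat) (L : set 'rV[R]_n) : Prop :=
  exists B : 'M[R]_n, lattice_basis B L.

Definition gram (R : realType) (n : nat) (B : 'M[R]_n) : 'M[R]_n := B *m B^T.

Definition dual_lattice (R : realType) (n : nat) (L : set 'rV[R]_n) :
    set 'rV[R]_n :=
  [set xi | forall v, L v -> dotv xi v \is a Num.int].

(* For the lattice with basis D, Y consists of the D-coordinates of exactly one
   vector of each pair +-xi of lattice vectors of length 1. *)
Definition unit_coordinates (R : realType) (n : nat) (D : 'M[R]_n)
    (Y : set 'rV[int]_n) : Prop :=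
  (forall a, Y a -> enorm (zrow R a *m D) = 1) /\
  (forall a, enorm (zrow R a *m D) = 1 ->
     (Y a \/ Y (- a)) /\ ~ (Y a /\ Y (- a))).

Definition posdef (R : realType) (n : nat) : set 'M[R]_n :=
  [set M | M^T = M /\ forall v : 'rV[R]_n, v != 0 -> 0 < (v *m M *m v^T) 0 0].
Arguments posdef : clear implicits.

Definition convex_hull (R : realType) (V : lmodType R) (S : set V) : set V :=
  [set p | exists (k : nat) (t : 'I_k -> R) (s : 'I_k -> V),
     [/\ forall i, 0 <= t i, \sum_i t i = 1, forall i, S (s i)
       & p = \sum_i t i *: s i]].

Definition affine_hull (R : realType) (V : lmodType R) (S : set V) : set V :=
  [set p | exists (k : nat) (t : 'I_k -> R) (s : 'I_k -> V),
     [/\ \sum_i t i = 1, forall i, S (s i) & p = \sum_i t i *: s i]].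

Definition relative_interior (R : realType) (V : normedModType R)
    (C : set V) : set V :=
  [set p | C p /\ exists2 e : R, 0 < e & ball p e `&` affine_hull C `<=` C].

Definition critical_point (R : realType) (V : normedModType R)
    (f : V -> R) (C : set V) (p : V) : Prop :=
  forall q q', affine_hull C q -> affine_hull C q' -> is_derive p (q - q') f 0.

Definition C_ (R : realType) (n : nat) (X : set 'rV[int]_n) : set 'M[R]_n :=
  convex_hull [set (zrow R a)^T *m zrow R a | a in X].
Arguments C_ R {n} X.

Definition partial (R : realType) (n : nat) (W : normedModType R) (i : 'I_n)
    (f : 'rV[R]_n -> W) : 'rV[R]_n -> W :=
  'D_(delta_mx 0 i) f.

Fixpoint Ck (R : realType) (n : nat) (W : normedModType R) (k : nat)
    (f : 'rV[R]_n -> W) : Prop :=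
  if k is k'.+1 then
    (forall u, differentiable f u) /\ forall i : 'I_n, Ck k' (partial i f)
  else continuous f.

Definition smooth (R : realType) (n : nat) (W : normedModType R)
    (f : 'rV[R]_n -> W) : Prop :=
  forall k, Ck k f.

(* Maps on the torus R^n/L are represented by their L-periodic lifts to R^n;
   the coordinates u_1, ..., u_n of R^n are local coordinates of the torus. *)
Definition periodic (R : realType) (n : nat) (T : Type) (L : set 'rV[R]_n)
    (f : 'rV[R]_n -> T) : Prop :=
  forall u v, L v -> f (u + v) = f u.

Definition torus_metric (R : realType) (n : nat) : 'M[R]_n :=
  (4 * pi ^+ 2 / n%:R)%:M.

(* The Laplace-Beltrami operator of a metric with constant coefficients g. *)
Definition laplacian (R : realType) (n : nat) (g : 'M[R]_n)
    (f : 'rV[R]_n -> R) (u : 'rV[R]_n) : R :=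
  \sum_i \sum_j invmx g i j * partial i (partial j f) u.

(* Eigenvalues are those of the nonnegative operator - laplacian g. *)
Definition torus_eigenspace (R : realType) (n : nat) (L : set 'rV[R]_n)
    (g : 'M[R]_n) (lambda : R) : set ('rV[R]_n -> R) :=
  [set f | [/\ smooth f, periodic L f
             & forall u, - laplacian g f u = lambda * f u]].

Definition has_dim (R : realType) (T : Type) (E : set (T -> R)) (d : nat) :
    Prop :=
  exists b : 'I_d -> T -> R,
    [/\ forall i, E (b i),
        forall t : 'I_d -> R,
          (forall u, \sum_i t i * b i u = 0) -> forall i, t i = 0
      & forall f, E f ->
          exists t : 'I_d -> R, forall u, f u = \sum_i t i * b i u].

Definition first_fundamental_form (R : realType) (n m : nat)
    (x : 'rV[R]_n -> 'rV[R]_m) (u : 'rV[R]_n) : 'M[R]_n :=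
  \matrix_(i, j) dotv (partial i x u) (partial j x u).

Record isometric_immersion (R : realType) (n m : nat) (L : set 'rV[R]_n)
    (g : 'M[R]_n) (x : 'rV[R]_n -> 'rV[R]_m) : Prop := {
  immersion_smooth : smooth x;
  immersion_periodic : periodic L x;
  immersion_sphere : forall u, enorm (x u) = 1;
  immersion_rank : forall u, row_free (jacobian x u);
  immersion_isometric : forall u, first_fundamental_form x u = g }.

(* Vectors normal to the immersed manifold inside the unit sphere at x u. *)
Definition sphere_normal (R : realType) (n m : nat)
    (x : 'rV[R]_n -> 'rV[R]_m) (u : 'rV[R]_n) : set 'rV[R]_m :=
  [set nu | dotv (x u) nu = 0 /\ forall i, dotv (partial i x u) nu = 0].

Definition second_fundamental_form (R : realType) (n m : nat)
    (x : 'rV[R]_n -> 'rV[R]_m) (u : 'rV[R]_n) (nu : 'rV[R]_m) : 'M[R]_n :=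
  \matrix_(i, j) dotv (partial i (partial j x) u) nu.

Definition mean_curvature (R : realType) (n m : nat)
    (x : 'rV[R]_n -> 'rV[R]_m) (u : 'rV[R]_n) (nu : 'rV[R]_m) : R :=
  n%:R^-1 * \tr (invmx (first_fundamental_form x u) *m
                 second_fundamental_form x u nu).

(* Vanishing of the mean curvature vector of the immersion into the sphere:
   mean_curvature x u nu is its inner product with the normal vector nu. *)
Definition minimal (R : realType) (n m : nat)
    (x : 'rV[R]_n -> 'rV[R]_m) : Prop :=
  forall u nu, sphere_normal x u nu -> mean_curvature x u nu = 0.

(* C^N is identified with R^(N + N), real parts first. *)
Definition exp_map (R : realType) (n N : nat) (xi : 'I_N -> 'rV[R]_n)
    (c : 'I_N -> R) (u : 'rV[R]_n) : 'rV[R]_(N + N) :=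
  row_mx (\row_j (c j * cos (2 * pi * dotv (xi j) u)))
         (\row_j (c j * sin (2 * pi * dotv (xi j) u))).

Definition homogeneous (R : realType) (n N : nat) (L : set 'rV[R]_n)
    (x : 'rV[R]_n -> 'rV[R]_(N + N)) : Prop :=
  exists (xi : 'I_N -> 'rV[R]_n) (c : 'I_N -> R) (O : 'M[R]_(N + N)),
    [/\ forall j, dual_lattice L (xi j), forall j, 0 <= c j,
        O *m O^T = 1%:M & forall u, x u = exp_map xi c u *m O].

Definition linearly_full (R : realType) (n m : nat)
    (x : 'rV[R]_n -> 'rV[R]_m) : Prop :=
  forall W : {vspace 'rV[R]_m}, (forall u, x u \in W) -> W = fullv.

(* Main.v *)
(* Up to an orthogonal frame a homogeneous map is
   [x u = (c_k e^(2 pi i <xi_k, u>))_k].  It induces the torus metric iff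
   [sum_k c_k^2 xi_k^T xi_k = I / n], and its Laplacian has coordinates
   proportional to [|xi_k|^2 x_k]; hence, when it is isometric into the sphere,
   it is minimal iff [|xi_k| = 1] whenever [c_k <> 0].  In coordinates
   [xi_k = a_k D] with respect to a basis [D] of the dual lattice, with Gram
   matrix [Q = D D^T], the first condition says that [P = Q^-1 / n] is the
   convex combination [sum_k c_k^2 a_k^T a_k].  Since the derivative of [det]
   at [P] is [H |-> det P tr (P^-1 H)], and [tr (P^-1 a^T a) = n |a D|^2], the
   second condition says that [P] is critical on the hull of the [a_k^T a_k].
   In (i), fullness makes all [c_k] nonzero and the waves of frequency [xi_k]
   linearly independent; the dimension count then makes them span the
   eigenspace, so that the [xi_k] exhaust the unit vectors of the dual lattice
   up to sign, and [P] has positive weight on every generator of the hull. *)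

Require Import Defs.
From HB Require Import structures.
From mathcomp Require Import all_boot all_order all_algebra.
From mathcomp Require Import all_classical all_reals all_analysis.
From mathcomp Require Import perm ring lra.

Import Order.TTheory GRing.Theory Num.Theory.
Import numFieldNormedType.Exports.

Set Implicit Arguments.
Unset Strict Implicit.
Unset Printing Implicit Defensive.

Local Open Scope classical_set_scope.
Local Open Scope ring_scope.

(** * Convex and affine hulls *)

Section hulls.
Context {R : realType} {V : lmodType R}.
Implicit Types (S : set V) (p q : V).

Lemma convex_hull_incl S : S `<=` convex_hull S.
Proof.
by move=> p Sp; exists 1%N, (fun=> 1), (fun=> p); rewrite !big_ord1 scale1r.
Qed.

Lemma convex_hull_sub_affine_hull S : convex_hull S `<=` affine_hull S.
Proof. by move=> p [k [t [s [_ t_sum1 Ss ->]]]]; exists k, t, s. Qed.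

Lemma affine_hull_incl S : S `<=` affine_hull S.
Proof. by move=> p /convex_hull_incl/convex_hull_sub_affine_hull. Qed.

Lemma affine_hullS S S' : S `<=` S' -> affine_hull S `<=` affine_hull S'.
Proof.
move=> SS' p [k [t [s [t_sum1 Ss ->]]]]; exists k, t, s.
by split => // i; exact/SS'.
Qed.

Lemma affine_hull_comb (I : finType) (t : I -> R) (s : I -> V) S :
  \sum_i t i = 1 -> (forall i, S (s i)) -> affine_hull S (\sum_i t i *: s i).
Proof.
move=> t_sum1 Ss; exists #|I|, (t \o enum_val), (s \o enum_val); split => //.
- by rewrite -t_sum1; symmetry; apply/reindex/onW_bij/enum_val_bij.
- by move=> i; exact: Ss.
- by apply/reindex/onW_bij/enum_val_bij.
Qed.

Lemma affine_hull_line S p q (r : R) :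
  S p -> S q -> affine_hull S (p + r *: (p - q)).
Proof.
move=> Sp Sq; have -> : p + r *: (p - q) =
    \sum_(b : bool) (if b then 1 + r else - r) *: (if b then p else q).
  by rewrite big_bool/= scalerDl scale1r scalerBr scaleNr addrA.
by apply: affine_hull_comb => [|[]//]; rewrite big_bool/= addrK.
Qed.

Lemma affine_hull_idem S : affine_hull (affine_hull S) = affine_hull S.
Proof.
apply/seteqP; split; last exact: affine_hull_incl.
move=> _ [k [t [s [t_sum1 sS ->]]]].
have {}sS i : exists d : {l & ('I_l -> R) * ('I_l -> V)}%type,
    [/\ \sum_j (tagged d).1 j = 1, forall j, S ((tagged d).2 j) &
        s i = \sum_j (tagged d).1 j *: (tagged d).2 j].
  by have [l [w [r ?]]] := sS i; exists (existT _ l (w, r)).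
have [d dP] := choice sS; pose l i := tag (d i).
pose w i := (tagged (d i)).1; pose r i := (tagged (d i)).2.
have -> : \sum_i t i *: s i =
    \sum_(ij : {i & 'I_(l i)})
      (t (tag ij) * w _ (tagged ij)) *: r _ (tagged ij).
  rewrite -(sig_big_dep xpredT (fun=> xpredT)
    (fun i j => (t i * w i j) *: r i j))/=; apply: eq_bigr => i _.
  have [_ _ ->] := dP i; rewrite scaler_sumr.
  by apply: eq_bigr => j _; rewrite scalerA.
apply: affine_hull_comb => [|[i j]]; last by have [_ + _] := dP i; apply.
rewrite -(sig_big_dep xpredT (fun=> xpredT) (fun i j => t i * w i j))/= -t_sum1.
apply: eq_bigr => i _; have [w_sum1 _ _] := dP i.
by rewrite -mulr_sumr w_sum1 mulr1.
Qed.

Lemma affine_hull_convex_hull S : affine_hull (convex_hull S) = affine_hull S.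
Proof.
apply/seteqP; split; last exact/affine_hullS/convex_hull_incl.
rewrite -[X in _ `<=` X]affine_hull_idem.
exact/affine_hullS/convex_hull_sub_affine_hull.
Qed.

Lemma affine_hull_range (I : finType) (s : I -> V) p :
  affine_hull (range s) p ->
  exists2 t : I -> R, \sum_i t i = 1 & p = \sum_i t i *: s i.
Proof.
case=> m [t [r [t_sum1 rs ->]]].
have {}rs i : exists j, s j = r i by have [j _ <-] := rs i; exists j.
have [h hP] := choice rs.
exists (fun j => \sum_(i | h i == j) t i).
  by rewrite -t_sum1 (partition_big h xpredT).
rewrite (partition_big h xpredT)//=; apply: eq_bigr => j _.
by rewrite scaler_suml; apply: eq_bigr => i /eqP <-; rewrite hP.
Qed.

Lemma affine_hull_scalar_const (f : {scalar V}) (c : R) S :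
  (forall p, S p -> f p = c) -> forall p, affine_hull S p -> f p = c.
Proof.
move=> fS _ [k [t [s [t_sum1 Ss ->]]]]; rewrite linear_sum/=.
under eq_bigr => i _ do rewrite linearZ/= fS//.
by rewrite -mulr_suml t_sum1 mul1r.
Qed.

End hulls.

Lemma continuous_linear_mx (R : realType) (m n : nat) (W : normedModType R)
    (f : {linear 'M[R]_(m, n) -> W}) : continuous f.
Proof.
have -> : f = (fun M => \sum_i \sum_j M i j *: f (delta_mx i j)) :> (_ -> _).
  apply/funext => M; rewrite {1}[M]matrix_sum_delta linear_sum.
  apply: eq_bigr => i _; rewrite linear_sum.
  by apply: eq_bigr => j _; rewrite linearZ.
apply: continuous_big => [|i _]; first exact: add_continuous.
apply: continuous_big => [|j _ M]; first exact: add_continuous.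
by apply: continuousZr_tmp; exact: coord_continuous.
Qed.

(* The coordinates are read off through a linear map, the partial inverse of the
   generators restricted to sum-zero weights, so they depend continuously on the
   direction. *)
Lemma affine_direction_coordinates (R : realType) (m n k : nat)
    (s : 'I_k -> 'M[R]_(m, n)) :
  exists f : {linear 'M[R]_(m, n) -> 'rV[R]_k},
    forall w : 'I_k -> R, \sum_i w i = 0 ->
    let h := \sum_i w i *: s i in
    \sum_i f h 0 i = 0 /\ \sum_i f h 0 i *: s i = h.
Proof.
pose S : 'M[R]_(k, m * n) := \matrix_i mxvec (s i).
pose Z : 'M[R]_k := kermx (const_mx 1 : 'cV[R]_k).
have mulS (w : 'rV[R]_k) : w *m S = mxvec (\sum_i w 0 i *: s i).
  rewrite mulmx_sum_row linear_sum; apply: eq_bigr => i _.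
  by rewrite rowK linearZ.
have mul_ones (w : 'rV[R]_k) : w *m (const_mx 1 : 'cV_k) = (\sum_i w 0 i)%:M.
  apply/matrixP => i j; rewrite !ord1 !mxE eqxx mulr1n.
  by apply: eq_bigr => l _; rewrite mxE mulr1.
exists (mulmxr (pinvmx (Z *m S) *m Z) \o mxvec) => w w_sum0 /=.
set h := \sum_i w i *: s i; set v := mxvec h *m _.
have hZS : (mxvec h <= Z *m S)%MS.
  have : (\row_i w i <= Z)%MS.
    apply/sub_kermxP; rewrite mul_ones; under eq_bigr do rewrite mxE.
    by rewrite w_sum0 raddf0.
  move=> /(submxMr S); rewrite mulS.
  by under eq_bigr do rewrite mxE.
have vS : v *m S = mxvec h.
  by rewrite /v -mulmxA -[X in _ *m X]mulmxA mulmxA mulmxKpV.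
have v_sum0 : v *m (const_mx 1 : 'cV_k) = 0.
  by rewrite /v mulmxA -mulmxA mulmx_ker mulmx0.
split; last by apply: (can_inj mxvecK); rewrite -mulS.
have := mul_ones v; rewrite v_sum0 => /matrixP/(_ 0 0).
by rewrite !mxE eqxx mulr1n.
Qed.

Lemma relative_interior_pos (R : realType) (m n k : nat)
    (s : 'I_k -> 'M[R]_(m, n)) (t : 'I_k -> R) :
  (forall i, 0 < t i) -> \sum_i t i = 1 ->
  relative_interior (convex_hull (range s)) (\sum_i t i *: s i).
Proof.
move=> t_gt0 t_sum1; set p := \sum_i _.
split; first by exists k, t, s; split => // i; rewrite ltW.
have [f fP] := affine_direction_coordinates s.
have near_pos i : \forall h \near nbhs (0 : 'M[R]_(m, n)), - t i < f h 0 i.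
  have f_cvg : f h 0 i @[h --> (0 : 'M[R]_(m, n))] --> f 0 0 i.
    apply: (@cvg_comp _ _ _ f (fun v : 'rV[R]_k => v 0 i)).
      exact: continuous_linear_mx.
    exact: coord_continuous.
  by apply: (cvgr_gt _ f_cvg); rewrite linear0 mxE oppr_lt0.
have /nbhs_ballP[e e_gt0 eP] : \forall h \near nbhs (0 : 'M[R]_(m, n)),
    forall i, - t i < f h 0 i by exact: filter_forall near_pos.
exists e => // q [pq]; rewrite affine_hull_convex_hull.
move=> /affine_hull_range[w w_sum1 qE].
have qpE : q - p = \sum_i (w i - t i) *: s i.
  by rewrite qE -sumrB; apply: eq_bigr => i _; rewrite scalerBl.
have [] := fP (fun i => w i - t i); first by rewrite sumrB w_sum1 t_sum1 subrr.
rewrite -qpE => f_sum0 fE; exists k, (fun i => t i + f (q - p) 0 i), s; split.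
- move=> i; rewrite -[t i]opprK addrC subr_ge0 ltW//; apply: eP.
  by move: pq; rewrite -!ball_normE/= sub0r normrN distrC.
- by rewrite big_split/= t_sum1 f_sum0 addr0.
- by move=> i; exists i.
- under eq_bigr do rewrite scalerDl.
  by rewrite big_split/= fE addrC subrK.
Qed.

(** * Positive definite matrices *)

Section dot_product.
Context {R : realType} {n : nat}.
Implicit Types u v : 'rV[R]_n.

Lemma dotvE u v : dotv u v = \sum_i u 0 i * v 0 i.
Proof. by rewrite /dotv mxE; apply: eq_bigr => i _; rewrite mxE. Qed.

Lemma dotvC u v : dotv u v = dotv v u.
Proof. by rewrite !dotvE; apply: eq_bigr => i _; rewrite mulrC. Qed.

Fact dotv_is_bilinear :
  bilinear_for (GRing.Scale.Law.clone _ _ *%R _)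
               (GRing.Scale.Law.clone _ _ *%R _) (@dotv R n).
Proof.
have lin v : linear_for *%R (dotv v).
  by move=> a u w; rewrite /dotv linearP mulmxDr -scalemxAr !mxE.
by split=> v a u w; rewrite ?lin// dotvC lin !(dotvC v).
Qed.

HB.instance Definition _ :=
  bilinear_isBilinear.Build R _ _ _ _ _ (@dotv R n) dotv_is_bilinear.

Lemma dotv_ge0 u : 0 <= dotv u u.
Proof. by rewrite dotvE; apply: sumr_ge0 => i _; rewrite -expr2 sqr_ge0. Qed.

Lemma dotv_eq0 u : (dotv u u == 0) = (u == 0).
Proof.
apply/eqP/eqP => [/eqP|->]; last by rewrite linear0l.
rewrite dotvE psumr_eq0 => [/allP u_eq0|i _]; last by rewrite -expr2 sqr_ge0.
apply/rowP => i; rewrite mxE; apply/eqP.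
by have := u_eq0 i (mem_index_enum _); rewrite /= mulf_eq0 orbb.
Qed.

Lemma enorm_eq1 u : enorm u = 1 <-> dotv u u = 1.
Proof.
rewrite /enorm; split => [u_unit|->]; last by rewrite sqrtr1.
by rewrite -[LHS]sqr_sqrtr ?dotv_ge0// u_unit expr1n.
Qed.

End dot_product.

Definition outer {R : realType} {n : nat} (v : 'rV[R]_n) : 'M[R]_n :=
  v^T *m v.

Definition quad {R : realType} {n : nat} (v : 'rV[R]_n) (M : 'M[R]_n) : R :=
  (v *m M *m v^T) 0 0.

Section quadratic_forms.
Context {R : realType}.

Lemma outerN (n : nat) (v : 'rV[R]_n) : outer (- v) = outer v.
Proof. by rewrite /outer mulmxN linearN/= mulNmx opprK. Qed.

Lemma outer_mulmx (m n : nat) (v : 'rV[R]_m) (A : 'M[R]_(m, n)) :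
  outer (v *m A) = A^T *m outer v *m A.
Proof. by rewrite /outer trmx_mul !mulmxA. Qed.

Lemma mxtrace_outer (n : nat) (v : 'rV[R]_n) : \tr (outer v) = dotv v v.
Proof. by rewrite mxtrace_mulC trace_mx11. Qed.

Lemma quad_mxtrace (n : nat) (v : 'rV[R]_n) (M : 'M[R]_n) :
  quad v M = \tr (M *m outer v).
Proof. by rewrite mulmxA mxtrace_mulC mulmxA trace_mx11. Qed.

Fact quad_is_linear (n : nat) (v : 'rV[R]_n) : linear_for *%R (quad v).
Proof.
by move=> a M M'; rewrite /quad mulmxDr mulmxDl -scalemxAr -scalemxAl !mxE.
Qed.

HB.instance Definition _ (n : nat) (v : 'rV[R]_n) :=
  GRing.isLinear.Build R 'M[R]_n R *%R (quad v) (quad_is_linear v).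

Lemma quad_mulmx (m n : nat) (v : 'rV[R]_m) (A : 'M[R]_(m, n)) (M : 'M[R]_n) :
  quad (v *m A) M = quad v (A *m M *m A^T).
Proof. by rewrite /quad trmx_mul !mulmxA. Qed.

Lemma quad_gram (n : nat) (v : 'rV[R]_n) (B : 'M[R]_n) :
  quad v (gram B) = dotv (v *m B) (v *m B).
Proof. by rewrite /dotv /quad /gram trmx_mul !mulmxA. Qed.

Lemma quad_outer (n : nat) (u v : 'rV[R]_n) :
  quad u (outer v) = dotv u v ^+ 2.
Proof.
rewrite /quad /outer mulmxA -mulmxA [u *m _]mx11_scalar mul_scalar_mx mxE.
by rewrite -!/(dotv _ _) (dotvC v).
Qed.

End quadratic_forms.

Definition psdef (R : realType) (n : nat) : set 'M[R]_n :=
  [set M | M^T = M /\ forall v, 0 <= quad v M].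
Arguments psdef : clear implicits.

Lemma psdef_convex_hull (R : realType) (n : nat) (S : set 'M[R]_n) :
  S `<=` psdef R n -> convex_hull S `<=` psdef R n.
Proof.
move=> Spsd _ [k [t [s [t_ge0 _ Ss ->]]]]; split => [|v].
  rewrite linear_sum; apply: eq_bigr => i _; rewrite linearZ/=.
  by have [-> _] := Spsd _ (Ss i).
rewrite linear_sum; apply: sumr_ge0 => i _; rewrite linearZ/= mulr_ge0//.
by have [_] := Spsd _ (Ss i).
Qed.

Lemma psdef_outer (R : realType) (n : nat) (v : 'rV[R]_n) :
  psdef R n (outer v).
Proof. by split=> [|u]; rewrite ?quad_outer ?sqr_ge0// trmx_mul trmxK. Qed.

(* The segment from a definite matrix of [C] to [P] can be prolonged beyond [P]
   inside [C], so [P] is a positive combination of a definite and a semidefinite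
   matrix. *)
Lemma relative_interior_posdef (R : realType) (n : nat) (C : set 'M[R]_n)
    (P : 'M[R]_n) :
  C `<=` psdef R n -> C `&` posdef R n !=set0 ->
  relative_interior C P -> posdef R n P.
Proof.
move=> Cpsd [Q [QC [_ Qpos]]] [PC [e e_gt0 eP]].
split=> [|v v_neq0]; first by have [] := Cpsd _ PC.
have dist_gt0 : 0 < `|P - Q| + 1 by rewrite ltr_wpDl.
pose r := e / (`|P - Q| + 1).
have r_gt0 : 0 < r by rewrite divr_gt0.
have [|_ /(_ v)] := Cpsd _ (eP (P + r *: (P - Q)) _).
  split; last exact: affine_hull_line.
  rewrite -ball_normE/= opprD addNKr normrN normrZ gtr0_norm//.
  by rewrite mulrAC ltr_pdivrMr// ltr_pM2l// ltrDl.
rewrite linearD linearZ linearB/= => PQ_ge0.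
have Q_gt0 : 0 < quad v Q := Qpos v v_neq0.
have : 0 < (1 + r) * quad v P.
  apply: lt_le_trans (mulr_gt0 r_gt0 Q_gt0) _.
  by move: PQ_ge0; rewrite mulrBr mulrDl mul1r; lra.
by rewrite pmulr_rgt0// addr_gt0.
Qed.

Section cholesky.
Context {R : realType}.

Lemma posdef_diag_gt0 (n : nat) (M : 'M[R]_n) (i : 'I_n) :
  posdef R n M -> 0 < M i i.
Proof.
move=> [_ /(_ (delta_mx 0 i))]; rewrite trmx_delta -rowE -colE !mxE; apply.
by apply/eqP => /matrixP/(_ 0 i); rewrite !mxE !eqxx => /eqP; rewrite oner_eq0.
Qed.

Lemma posdef_congr (m n : nat) (A : 'M[R]_(m, n)) (M : 'M[R]_n) :
  row_free A -> posdef R n M -> posdef R m (A *m M *m A^T).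
Proof.
move=> Afree [Msym Mpos]; split=> [|v v_neq0].
  by rewrite !trmx_mul trmxK Msym mulmxA.
by rewrite -/(quad _ _) -quad_mulmx; apply: Mpos; rewrite mulmx_free_eq0.
Qed.

Lemma posdef_drsubmx (m n : nat) (M : 'M[R]_(m + n)) :
  posdef R _ M -> posdef R n (drsubmx M).
Proof.
have -> : drsubmx M = row_mx 0 1%:M *m M *m (row_mx 0 1%:M)^T.
  rewrite -{2}[M]submxK mul_row_block tr_row_mx mul_row_col !trmx1 !mul1mx.
  by rewrite !mul0mx trmx0 mulmx0 !add0r mulmx1.
apply: posdef_congr; apply/row_freeP; exists (col_mx 0 1%:M).
by rewrite mul_row_col mul0mx add0r mulmx1.
Qed.

Lemma gram_mulmx (n : nat) (A B : 'M[R]_n) :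
  gram (A *m B) = A *m gram B *m A^T.
Proof. by rewrite /gram trmx_mul !mulmxA. Qed.

Lemma gram_block_diag (m n : nat) (A : 'M[R]_m) (B : 'M[R]_n) :
  gram (block_mx A 0 0 B) = block_mx (gram A) 0 0 (gram B).
Proof.
by rewrite /gram tr_block_mx mulmx_block !trmx0 !mul0mx !mulmx0 !addr0 !add0r.
Qed.

Lemma schur_congr (m n : nat) (M : 'M[R]_(m + n)) :
  M^T = M -> ulsubmx M \in unitmx ->
  exists2 A : 'M[R]_(m + n), A \in unitmx &
    exists S, A *m M *m A^T = block_mx (ulsubmx M) 0 0 S.
Proof.
move=> Msym Uu; set U := ulsubmx M in Uu *.
have UT : U^T = U by rewrite trmx_ulsub Msym.
have dlE : dlsubmx M = (ursubmx M)^T by rewrite trmx_ursub Msym.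
pose K := dlsubmx M *m invmx U.
exists (block_mx 1%:M 0 (- K) 1%:M).
  by rewrite unitmxE det_lblock !det1 mulr1 unitr1.
exists (drsubmx M - K *m ursubmx M).
rewrite -{1}[M]submxK tr_block_mx !trmx1 trmx0 -/U !mulmx_block.
rewrite !mul1mx !mul0mx !mulmx1 !mulmx0 !addr0 !mulNmx mulmxKV// addNr.
rewrite linearN/= mul0mx add0r mulmxN /K trmx_mul trmx_inv UT dlE trmxK mulmxA.
by rewrite mulmxV// mul1mx addNr addrC.
Qed.

Lemma cholesky (n : nat) (P : 'M[R]_n) :
  posdef R n P -> exists2 B : 'M[R]_n, B \in unitmx & gram B = P.
Proof.
elim: n P => [|n IHn] P Ppos.
  by exists 1%:M; rewrite ?unitmx1//; apply/matrixP => -[].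
rewrite -[n.+1]/(1 + n)%N in P Ppos *.
have ul_gt0 : 0 < ulsubmx P 0 0 by rewrite !mxE; exact: posdef_diag_gt0.
have Uu : ulsubmx P \in unitmx.
  by rewrite [ulsubmx P]mx11_scalar unitmxE det_scalar1 unitfE gt_eqF.
have [A Au [S AP]] := schur_congr Ppos.1 Uu.
have Afree : row_free A by rewrite row_free_unit.
have := posdef_drsubmx (posdef_congr Afree Ppos).
rewrite AP block_mxKdr => /IHn[B Bu BS].
pose C : 'M[R]_(1 + n) := block_mx (Num.sqrt (ulsubmx P 0 0))%:M 0 0 B.
exists (invmx A *m C).
  rewrite unitmx_mul unitmx_inv Au unitmxE det_ublock det_scalar1 unitrM.
  by rewrite unitfE sqrtr_eq0 -ltNge ul_gt0.
have CE : gram C = A *m P *m A^T.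
  rewrite AP gram_block_diag BS; congr block_mx.
  rewrite /gram tr_scalar_mx -scalar_mxM -expr2 sqr_sqrtr ?ltW//.
  by rewrite -mx11_scalar.
by rewrite gram_mulmx CE trmx_inv !mulmxA mulVmx// mul1mx mulmxK ?unitmx_tr.
Qed.

End cholesky.

(** * The derivative of the determinant *)

Lemma deriv_prod (R : comNzRingType) (n : nat) (p : 'I_n -> {poly R}) :
  (\prod_i p i)^`() = \sum_i (p i)^`() * \prod_(j | j != i) p j.
Proof.
elim: n p => [|n IHn] p; first by rewrite !big_ord0 derivC.
rewrite big_ord_recl derivM IHn big_ord_recl; congr (_ * _ + _).
  by rewrite [RHS]big_mkcond big_ord_recl /= mul1r; apply: eq_bigr.
rewrite mulr_sumr; apply: eq_bigr => i _.
rewrite [in RHS]big_mkcond big_ord_recl/= mulrCA; congr (_ * (_ * _)).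
by rewrite big_mkcond; apply: eq_bigr => j _; rewrite (inj_eq lift_inj).
Qed.

Lemma deriv_det (R : comNzRingType) (n : nat) (M : 'M[{poly R}]_n) :
  (\det M)^`() = \tr (\adj M *m map_mx deriv M).
Proof.
pose D k := \matrix_(i, j) if i == k then (M i j)^`() else M i j.
transitivity (\sum_k \det (D k)).
  rewrite /determinant exchange_big/= raddf_sum; apply: eq_bigr => s _.
  have prodE : (\prod_i M i (s i))^`() = \sum_k \prod_i D k i (s i).
    rewrite deriv_prod; apply: eq_bigr => k _.
    rewrite [RHS](bigD1 k)//= mxE eqxx; congr (_ * _).
    by apply: eq_bigr => i /negbTE ik; rewrite mxE ik.
  by rewrite -mulr_sumr -prodE !mulr_sign; case: ifP => _ //; rewrite raddfN.
rewrite /mxtrace; under [RHS]eq_bigr do rewrite mxE.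
rewrite [RHS]exchange_big; apply: eq_bigr => k _; rewrite (expand_det_row _ k).
apply: eq_bigr => j _; rewrite !mxE eqxx mulrC; congr (_ * \det _ * _).
by apply/matrixP => i l; rewrite !mxE eq_sym (negbTE (neq_lift k i)).
Qed.

Lemma is_derive_line (R : realType) (V W : normedModType R) (f : V -> W)
    (x v : V) (df : W) :
  is_derive (0 : R) 1 (fun h => f (h *: v + x)) df -> is_derive x v f df.
Proof.
move=> [fd <-]; split; first exact/derivable1P.
rewrite /derive; set q := (X in lim (X @ _)); set q' := (X in _ = lim (X @ _)).
suff -> : q = q' by [].
by apply/funext => h; rewrite /q /q' /= addr0 scale0r add0r [_%:A]mulr1.
Qed.

Lemma is_derive_det (R : realType) (n : nat) (P H : 'M[R]_n) :
  is_derive P H (fun M : 'M[R]_n => \det M) (\tr (\adj P *m H)).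
Proof.
pose M : 'M[{poly R}]_n := 'X *: map_mx polyC H + map_mx polyC P.
have evalM t : map_mx (horner_eval t) M = t *: H + P.
  by apply/matrixP => i j; rewrite !mxE /= horner_evalE !hornerE.
apply: is_derive_line.
have -> : (fun t => \det (t *: H + P)) = horner (\det M).
  by apply/funext => t; rewrite -horner_evalE -det_map_mx evalM.
apply: is_derive_eq (is_derive_poly _ _) _.
rewrite deriv_det -horner_evalE -trace_map_mx map_mxM map_mx_adj evalM.
rewrite scale0r add0r; congr (\tr (_ *m _)).
by apply/matrixP => i j; rewrite !mxE /= horner_evalE !poly.derivE !hornerE.
Qed.

Lemma critical_point_det_hull (R : realType) (n : nat) (S : set 'M[R]_n)
    (P : 'M[R]_n) :
  P \in unitmx -> affine_hull S P ->
  critical_point (fun M : 'M[R]_n => \det M) (convex_hull S) P <->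
  forall M, S M -> \tr (invmx P *m M) = n%:R.
Proof.
move=> Pu SP; rewrite /critical_point affine_hull_convex_hull.
have adjE : \adj P = \det P *: invmx P.
  by rewrite /invmx Pu scalerA divrr ?scale1r// -unitmxE.
split=> [crit M SM|tr_n q q' Sq Sq'].
  have dP := crit M P (affine_hull_incl SM) SP.
  have := derive_val (is_derive := is_derive_det P (M - P)).
  rewrite (derive_val (is_derive := dP)) adjE -scalemxAl mxtraceZ.
  move=> /esym/eqP; rewrite mulf_eq0 -[_ == 0]negbK -unitfE -unitmxE Pu/=.
  rewrite mulmxBr linearB/= mulVmx// mxtrace1 subr_eq0.
  by move=> /eqP.
have trE := affine_hull_scalar_const (f := mxtrace \o mulmx (invmx P)) tr_n.
have [/= qn q'n] := (trE q Sq, trE q' Sq').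
apply: is_derive_eq (is_derive_det P (q - q')) _.
by rewrite adjE -scalemxAl mxtraceZ mulmxBr linearB/= qn q'n subrr mulr0.
Qed.

(** * Trigonometric maps *)

Lemma is_diff_sum (R : numFieldType) (V W : normedModType R) (n : nat)
    (f df : 'I_n -> V -> W) (x : V) :
  (forall i, is_diff x (f i) (df i)) ->
  is_diff x (\sum_i f i) (\sum_i df i).
Proof.
move=> f_diff; elim/big_ind2: _ => // [|g dg h dh]; first exact: is_diff_cst.
exact: is_diffD.
Qed.

Lemma pi_neq0 (R : realType) : (pi : R) != 0.
Proof. by rewrite gt_eqF// pi_gt0. Qed.

Section phase.
Context {R : realType} {n : nat}.
Implicit Types xi u : 'rV[R]_n.

Definition phase xi u : R := 2 * pi * dotv xi u.

Fact phase_is_linear xi : linear (phase xi : 'rV[R]_n -> R^o).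
Proof. by move=> a u v; rewrite /phase linearPr mulrDr mulrCA. Qed.

HB.instance Definition _ xi :=
  GRing.isLinear.Build R 'rV[R]_n R^o _ (phase xi) (phase_is_linear xi).

Lemma phase_delta xi (i : 'I_n) : phase xi (delta_mx 0 i) = 2 * pi * xi 0 i.
Proof. by rewrite /phase /dotv trmx_delta -colE mxE. Qed.

Lemma sum_phase_delta_sqr xi :
  \sum_i phase xi (delta_mx 0 i) ^+ 2 = 4 * pi ^+ 2 * dotv xi xi.
Proof.
rewrite dotvE mulr_sumr; apply: eq_bigr => i _; rewrite phase_delta; ring.
Qed.

Lemma is_diff_phase xi u : is_diff u (phase xi : 'rV[R]_n -> R^o) (phase xi).
Proof.
have phase_cont : continuous (phase xi : 'rV[R]_n -> R^o).
  exact: continuous_linear_mx.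
by apply: DiffDef; [exact/linear_differentiable|rewrite diff_lin].
Qed.

Lemma is_diff_comp_phase (W : normedModType R) (f : R -> R) (df : R) (w : W)
    xi u :
  is_derive (phase xi u) 1 f df ->
  is_diff u (fun u => f (phase xi u) *: w) (fun v => (phase xi v * df) *: w).
Proof.
move=> [/derivable1_diffP f_diffble fE].
have f_diff : is_diff (phase xi u) f (fun h => h * df).
  by apply: DiffDef => //; rewrite diff1E// derive1E fE.
have phase_diff := is_diff_phase xi u.
exact: is_diff_comp (is_diff_comp phase_diff f_diff) (is_diff_scalel _ _).
Qed.

End phase.

Lemma periodicz (U V : zmodType) (f : U -> V) (T : U) :
  trigo.periodic f T -> forall (z : int) (a : U), f (a + T *~ z) = f a.
Proof.
move=> f_per [m|m] a; first exact: periodicn.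
by rewrite NegzE mulrNz -[LHS](periodicn f_per m.+1) subrK.
Qed.

Section trigonometric_maps.
Context {R : realType} {n N : nat} {W : normedModType R}.
Implicit Types (xi : 'I_N -> 'rV[R]_n) (a b : 'I_N -> W) (L : set 'rV[R]_n).

Definition trig xi a b (u : 'rV[R]_n) : W :=
  \sum_k (cos (phase (xi k) u) *: a k + sin (phase (xi k) u) *: b k).

Lemma is_diff_trig xi a b u :
  is_diff u (trig xi a b)
    (fun v => trig xi (fun k => phase (xi k) v *: b k)
                      (fun k => - (phase (xi k) v *: a k)) u).
Proof.
have term k : is_diff u
    ((fun v => cos (phase (xi k) v) *: a k) +
     (fun v => sin (phase (xi k) v) *: b k))
    ((fun v => (phase (xi k) v * - sin (phase (xi k) u)) *: a k) +
     (fun v => (phase (xi k) v * cos (phase (xi k) u)) *: b k)).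
  by apply: is_diffD; apply: is_diff_comp_phase.
have -> : trig xi a b = \sum_k ((fun v => cos (phase (xi k) v) *: a k) +
    (fun v => sin (phase (xi k) v) *: b k)).
  by apply/funext => v; rewrite fct_sumE.
apply: is_diff_eq (is_diff_sum term) _; apply/funext => v; rewrite fct_sumE.
apply: eq_bigr => k _; rewrite addrC [in LHS]fctE scalerN !scalerA.
by rewrite !(mulrC (phase _ v)) mulNr scaleNr.
Qed.

Lemma differentiable_trig xi a b u : differentiable (trig xi a b) u.
Proof. by have trig_diff := is_diff_trig xi a b u; exact: ex_diff. Qed.

Lemma derive_trig xi a b (v : 'rV[R]_n) :
  'D_v (trig xi a b) = trig xi (fun k => phase (xi k) v *: b k)
                               (fun k => - (phase (xi k) v *: a k)).
Proof.
apply/funext => u; have trig_diff := is_diff_trig xi a b u.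
by rewrite deriveE ?diff_val//; exact: differentiable_trig.
Qed.

Lemma derive2_trig xi a b (v : 'rV[R]_n) :
  'D_v ('D_v (trig xi a b)) =
  trig xi (fun k => - (phase (xi k) v ^+ 2) *: a k)
          (fun k => - (phase (xi k) v ^+ 2) *: b k).
Proof.
rewrite !derive_trig; congr trig; apply/funext => k.
  by rewrite scalerN scalerA -expr2 scaleNr.
by rewrite scalerA -expr2 scaleNr.
Qed.

Lemma derive2_trigD xi a b (v u : 'rV[R]_n) (c : R) :
  'D_v ('D_v (trig xi a b)) u + c *: trig xi a b u =
  trig xi (fun k => (c - phase (xi k) v ^+ 2) *: a k)
          (fun k => (c - phase (xi k) v ^+ 2) *: b k) u.
Proof.
rewrite (congr1 (@^~ u) (derive2_trig xi a b v)) scaler_sumr -big_split.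
apply: eq_bigr => k _ /=; rewrite scalerDr addrACA !scalerA -!scalerDl.
by congr (_ *: _ + _ *: _); ring.
Qed.

Lemma sum_partial2_trig xi a b u :
  \sum_i partial i (partial i (trig xi a b)) u =
  - (4 * pi ^+ 2) *: trig xi (fun k => dotv (xi k) (xi k) *: a k)
                             (fun k => dotv (xi k) (xi k) *: b k) u.
Proof.
under eq_bigr => i _ do
  rewrite (derive2_trig xi a b (delta_mx 0 i) : partial i (partial i _) = _).
rewrite exchange_big scaler_sumr; apply: eq_bigr => k _; rewrite big_split/=.
rewrite -!scaler_sumr -!scaler_suml sumrN sum_phase_delta_sqr scalerDr.
by rewrite !scalerA; congr (_ *: _ + _ *: _); ring.
Qed.

Lemma smooth_trig xi a b : smooth (trig xi a b).
Proof.
move=> k; elim: k a b => [|k IHk] a b /=.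
  by move=> u; exact/differentiable_continuous/differentiable_trig.
by split=> [u|i]; [exact: differentiable_trig|rewrite /partial derive_trig].
Qed.

Lemma periodic_trig xi a b L :
  (forall k, dual_lattice L (xi k)) -> Defs.periodic L (trig xi a b).
Proof.
move=> xiL u v Lv; apply: eq_bigr => k _; rewrite linearD/=.
have /intrP[z zE] := xiL k v Lv.
have -> : phase (xi k) v = pi *+ 2 *~ z.
  by rewrite /phase zE -mulrzr mulr2n; ring.
by rewrite (periodicz (@cosD2pi R)) (periodicz (@sinD2pi R)).
Qed.

End trigonometric_maps.

Lemma exists_phase_sqr_neq (R : realType) (n : nat) (xi eta : 'rV[R]_n) :
  eta != xi -> eta != - xi -> exists v, phase eta v ^+ 2 != phase xi v ^+ 2.
Proof.
rewrite -subr_eq0 -dotv_eq0 -(subr_eq0 eta (- xi)) opprK.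
rewrite -(dotv_eq0 (eta + xi)) => sub_neq0 add_neq0.
suff [v subv addv] : exists2 v,
    dotv (eta - xi) v != 0 & dotv (eta + xi) v != 0.
  exists v; rewrite !exprMn -subr_eq0 -mulrBr subr_sqr -linearBl -linearDl/=.
  by rewrite !mulf_neq0// ?sqrf_eq0// pi_neq0.
have [orth|not_orth] := eqVneq (dotv (eta - xi) (eta + xi)) 0.
  exists (eta - xi + (eta + xi)); first by rewrite linearDr/= orth addr0.
  by rewrite linearDr/= dotvC orth add0r.
by exists (eta + xi).
Qed.

(* For [j != k] the operator [phase (xi j) v ^+ 2 + 'D_v 'D_v] annihilates the
   waves of frequency [xi j] and rescales the others, by a nonzero factor at
   frequency [xi k]. *)
Lemma trig_eq0 (R : realType) (n N : nat) (W : normedModType R)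
    (xi : 'I_N -> 'rV[R]_n) (a b : 'I_N -> W) (k : 'I_N) :
  (forall j, j != k -> xi k != xi j) -> (forall j, j != k -> xi k != - xi j) ->
  trig xi a b = cst 0 -> a k = 0.
Proof.
elim: N xi a b k => [|N IHN] xi a b k; first by case: k.
move=> neq neqN trig0; have [/= j jk|only_k] := pickP (predC1 k); last first.
  have := congr1 (@^~ 0) trig0; rewrite /= /trig (eq_bigl (pred1 k)) => [|j].
    by rewrite big_pred1_eq linear0/= cos0 sin0 scale1r scale0r addr0.
  by have := only_k j; rewrite /= => /negbFE.
have [v] := exists_phase_sqr_neq (neq j jk) (neqN j jk).
pose c := phase (xi j) v ^+ 2; rewrite -/c => ck.
have [k' kE|kj] := unliftP j k; last by rewrite kj eqxx in jk.
pose scale (p : 'I_N.+1 -> W) l := (c - phase (xi l) v ^+ 2) *: p l.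
have scaled0 : trig xi (scale a) (scale b) = cst 0.
  have derive_cst0 : 'D_v (cst 0 : 'rV[R]_n -> W) = cst 0.
    by apply/funext => u; rewrite derive_cst.
  apply/funext => u; rewrite -derive2_trigD trig0 derive_cst0 derive_cst.
  by rewrite scaler0 addr0.
suff /eqP : scale a k = 0.
  by rewrite scaler_eq0 subr_eq0 eq_sym (negbTE ck) => /eqP.
rewrite kE; apply: (IHN (xi \o lift j) (scale a \o lift j) (scale b \o lift j)).
- by move=> l lk /=; rewrite -kE neq// kE (inj_eq lift_inj).
- by move=> l lk /=; rewrite -kE neqN// kE (inj_eq lift_inj).
rewrite -scaled0; apply/funext => u; rewrite [RHS](bigD1_ord j)//=.
by rewrite /scale subrr !scale0r !scaler0 addr0 add0r.
Qed.

Lemma cos_phase_independent (R : realType) (n N : nat) (W : normedModType R)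
    (xi : 'I_N -> 'rV[R]_n) (a b : 'I_N -> W) (eta : 'rV[R]_n) (A : W) :
  (forall k, eta != xi k) -> (forall k, eta != - xi k) ->
  (forall u, cos (phase eta u) *: A = trig xi a b u) -> A = 0.
Proof.
move=> neq neqN eqA.
pose cons T (x : T) (f : 'I_N -> T) i := oapp f x (unlift ord0 i).
have := @trig_eq0 R n N.+1 W (cons _ eta xi) (cons _ (- A) a) (cons _ 0 b) ord0.
rewrite /cons unlift_none/= => A_eq0.
apply/eqP; rewrite -oppr_eq0; apply/eqP/A_eq0.
- by move=> j; case: unliftP => [k _ _|->]; [exact: neq|rewrite eqxx].
- by move=> j; case: unliftP => [k _ _|->]; [exact: neqN|rewrite eqxx].
apply/funext => u; rewrite /trig big_ord_recl unlift_none/= scaler0 addr0.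
rewrite scalerN eqA addrC; apply/eqP; rewrite subr_eq0; apply/eqP.
by apply: eq_bigr => k _; rewrite liftK.
Qed.

(** * Eigenfunctions of the torus *)

Lemma laplacian_scalar (R : realType) (n : nat) (s : R) (f : 'rV[R]_n -> R)
    (u : 'rV[R]_n) :
  laplacian s%:M f u = s^-1 * \sum_i partial i (partial i f) u.
Proof.
rewrite /laplacian invmx_scalar mulr_sumr; apply: eq_bigr => i _.
rewrite (bigD1 i)//= mxE eqxx mulr1n big1 ?addr0// => j ji.
by rewrite mxE eq_sym (negbTE ji) mulr0n mul0r.
Qed.

Lemma trig_eigenspace (R : realType) (n N : nat) (L : set 'rV[R]_n)
    (xi : 'I_N -> 'rV[R]_n) (a b : 'I_N -> R^o) :
  (forall k, dual_lattice L (xi k)) -> (forall k, dotv (xi k) (xi k) = 1) ->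
  torus_eigenspace L (torus_metric R n) n%:R (trig xi a b).
Proof.
move=> xiL xi_unit.
split=> [||u]; [exact: smooth_trig|exact: periodic_trig|].
rewrite laplacian_scalar sum_partial2_trig.
have -> : (fun k => dotv (xi k) (xi k) *: a k) = a.
  by apply/funext => k; rewrite xi_unit scale1r.
have -> : (fun k => dotv (xi k) (xi k) *: b k) = b.
  by apply/funext => k; rewrite xi_unit scale1r.
rewrite /GRing.scale/= mulNr mulrN opprK mulrA invf_div divfK//.
by rewrite mulf_neq0// sqrf_eq0 pi_neq0.
Qed.

Lemma inj_mulmx_unit (F : fieldType) (n : nat) (A : 'M[F]_n) :
  (forall w : 'cV_n, A *m w = 0 -> w = 0) -> A \in unitmx.
Proof.
move=> A_inj; rewrite -unitmx_tr -row_free_unit; apply/inj_row_free => w wA.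
apply: trmx_inj; rewrite trmx0; apply: A_inj.
by rewrite -[A]trmxK -trmx_mul wA trmx0.
Qed.

Lemma has_dim_span (R : realType) (T : Type) (E : set (T -> R)) (d : nat)
    (f : T -> 'rV[R]_d) (g : T -> R) :
  has_dim E d -> (forall i, E (fun u => f u 0 i)) ->
  (forall w : 'cV_d, (forall u, f u *m w = 0) -> w = 0) ->
  E g -> exists w : 'cV_d, forall u, g u = (f u *m w) 0 0.
Proof.
move=> [b [_ _ bspan]] Ef f_free Eg; pose B u : 'rV[R]_d := \row_i b i u.
have span h : E h -> exists w : 'cV_d, forall u, h u = (B u *m w) 0 0.
  move=> /bspan[t tP]; exists (\col_i t i) => u; rewrite tP mxE.
  by apply: eq_bigr => i _; rewrite !mxE mulrC.
have [M fM] := choice (fun i => span _ (Ef i)).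
pose A : 'M[R]_d := \matrix_(i, j) M j i 0.
have fE u : f u = B u *m A.
  by apply/rowP => j; rewrite fM !mxE; apply: eq_bigr => i _; rewrite !mxE.
have Au : A \in unitmx.
  apply: inj_mulmx_unit => w wA; apply: f_free => u.
  by rewrite fE -mulmxA wA mulmx0.
have [w gw] := span g Eg; exists (invmx A *m w) => u.
by rewrite gw fE mulmxA mulmxK.
Qed.

Section linearly_full.
Context {R : realType} {n m : nat}.
Implicit Type f : 'rV[R]_n -> 'rV[R]_m.

Lemma linearly_full_free f (w : 'cV[R]_m) :
  linearly_full f -> (forall u, f u *m w = 0) -> w = 0.
Proof.
move=> full fw; pose h : 'Hom('rV[R]_m, 'M[R]_(1, 1)) := linfun (mulmxr w).
have kerT : lker h = fullv by apply: full => u; rewrite memv_ker lfunE/= fw.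
apply/matrixP => i j; have : delta_mx 0 i \in lker h by rewrite kerT memvf.
by rewrite memv_ker lfunE/= -rowE => /eqP/matrixP/(_ 0 j); rewrite !mxE.
Qed.

Lemma linearly_full_mulmx f (A : 'M[R]_m) :
  linearly_full (fun u => f u *m A) -> A \in unitmx /\ linearly_full f.
Proof.
move=> full; split.
  apply: inj_mulmx_unit => w wA; apply: linearly_full_free full _ => u.
  by rewrite -mulmxA wA mulmx0.
move=> W fW; pose h : 'End('rV[R]_m) := linfun (mulmxr A).
have hW : (h @: W)%VS = fullv.
  by apply: full => u; have := memv_img h (fW u); rewrite lfunE.
by apply/eqP; rewrite eqEdim subvf -hW/= -(limg_ker_dim h W) leq_addl.
Qed.

End linearly_full.

Section frequencies.
Context {R : realType} {n N : nat}.
Variable xi : 'I_N -> 'rV[R]_n.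

Lemma exp_map_mulmx (w : 'cV[R]_(N + N)) (u : 'rV[R]_n) :
  (exp_map xi (fun=> 1) u *m w) 0 0 =
  trig xi (fun k => w (lshift N k) 0 : R^o) (fun k => w (rshift N k) 0 : R^o) u.
Proof.
rewrite mxE big_split_ord/= -big_split/=; apply: eq_bigr => k _.
by rewrite row_mxEl row_mxEr !mxE !mul1r.
Qed.

Lemma exp_map_diag (c : 'I_N -> R) (u : 'rV[R]_n) :
  exp_map xi c u =
  exp_map xi (fun=> 1) u *m diag_mx (row_mx (\row_k c k) (\row_k c k)).
Proof.
apply/rowP => j; rewrite mul_mx_diag [RHS]mxE /exp_map.
by have [k ->|k ->] := split_ordP j;
  rewrite ?(row_mxEl, row_mxEr) !mxE mul1r mulrC.
Qed.

Lemma linearly_full_exp (c : 'I_N -> R) (U : 'M[R]_(N + N)) :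
  linearly_full (fun u => exp_map xi c u *m U) ->
  (forall k, c k != 0) /\ linearly_full (exp_map xi (fun=> 1)).
Proof.
pose C := diag_mx (row_mx (\row_k c k) (\row_k c k)).
have -> : (fun u => exp_map xi c u *m U) =
    (fun u => exp_map xi (fun=> 1) u *m (C *m U)).
  by apply/funext => u; rewrite exp_map_diag mulmxA.
move=> /linearly_full_mulmx[CU waves_full]; split=> // k.
move: CU; rewrite unitmx_mul => /andP[+ _].
rewrite unitmxE unitfE det_diag => /prodf_neq0/(_ (lshift N k) isT).
by rewrite row_mxEl mxE.
Qed.

Variable L : set 'rV[R]_n.
Hypothesis xiL : forall k, dual_lattice L (xi k).
Hypothesis xi_unit : forall k, dotv (xi k) (xi k) = 1.

Lemma exp_map_eigenspace (i : 'I_(N + N)) :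
  torus_eigenspace L (torus_metric R n) n%:R
    (fun u => exp_map xi (fun=> 1) u 0 i).
Proof.
have -> : (fun u => exp_map xi (fun=> 1) u 0 i) =
    (fun u => (exp_map xi (fun=> 1) u *m (delta_mx i 0 : 'cV_(N + N))) 0 0).
  by apply/funext => u; rewrite -colE [RHS]mxE.
by under eq_fun do rewrite exp_map_mulmx; exact: trig_eigenspace.
Qed.

Lemma full_unit_frequencies (eta : 'rV[R]_n) :
  has_dim (torus_eigenspace L (torus_metric R n) n%:R) (N + N) ->
  linearly_full (exp_map xi (fun=> 1)) ->
  dual_lattice L eta -> dotv eta eta = 1 ->
  exists k, eta = xi k \/ eta = - xi k.
Proof.
move=> dimE full etaL eta_unit; apply: contrapT => eta_new.
have cosE : torus_eigenspace L (torus_metric R n) n%:R (cos \o phase eta).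
  have -> : cos \o phase eta =
      trig (fun=> eta) (fun=> 1 : R^o) (fun=> 0 : R^o) (N := 1).
    apply/funext => u; rewrite /trig big_ord1 /= /GRing.scale/=.
    by rewrite mulr1 mulr0 addr0.
  exact: trig_eigenspace.
have [w wP] := has_dim_span dimE exp_map_eigenspace
  (fun w => linearly_full_free full) cosE.
have /eqP := oner_neq0 R; apply.
apply: (@cos_phase_independent R n N R^o xi (fun k => w (lshift N k) 0)
  (fun k => w (rshift N k) 0) eta) => [k|k|u].
- by apply/eqP => etaE; apply: eta_new; exists k; left.
- by apply/eqP => etaE; apply: eta_new; exists k; right.
- by rewrite -exp_map_mulmx -wP /GRing.scale/= mulr1.
Qed.

End frequencies.

(** * Exponential immersions *)

Section immersions.
Context {R : realType} {n m : nat}.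
Variables (x : 'rV[R]_n -> 'rV[R]_m) (u : 'rV[R]_n).

Lemma jacobian_mul_tr : differentiable x u ->
  jacobian x u *m (jacobian x u)^T = first_fundamental_form x u.
Proof.
move=> x_diff; apply/matrixP => i j.
rewrite [RHS]mxE /partial !deriveEjacobian// -!rowE dotvE mxE.
by apply: eq_bigr => k _; rewrite ![row _ _ _ _]mxE [_^T _ _]mxE.
Qed.

Lemma row_free_jacobian : differentiable x u ->
  first_fundamental_form x u \in unitmx -> row_free (jacobian x u).
Proof.
move=> x_diff fff_unit.
rewrite -row_leq_rank -{1}(mxrank_unit fff_unit) -jacobian_mul_tr//.
exact: mxrankM_maxl.
Qed.

Lemma mean_curvature_scalar (s : R) (nu : 'rV[R]_m) :
  first_fundamental_form x u = s%:M ->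
  mean_curvature x u nu =
  n%:R^-1 * (s^-1 * dotv (\sum_i partial i (partial i x) u) nu).
Proof.
move=> fffE; rewrite /mean_curvature fffE invmx_scalar mul_scalar_mx mxtraceZ.
rewrite linear_sumlz/=; congr (_ * (_ * _)).
by apply: eq_bigr => i _; rewrite mxE.
Qed.

End immersions.

Definition frame_mx {R : realType} {n N : nat} (xi : 'I_N -> 'rV[R]_n)
    (c : 'I_N -> R) : 'M[R]_n :=
  \sum_k c k ^+ 2 *: outer (xi k).

Section frame_mx.
Context {R : realType} {n N : nat}.
Variables (xi : 'I_N -> 'rV[R]_n) (c : 'I_N -> R).

Lemma frame_mx_mulmx (D : 'M[R]_n) :
  frame_mx (fun k => xi k *m D) c = D^T *m frame_mx xi c *m D.
Proof.
rewrite mulmx_sumr mulmx_suml; apply: eq_bigr => k _.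
by rewrite outer_mulmx -scalemxAr -scalemxAl.
Qed.

Lemma mxtrace_frame_mx :
  \tr (frame_mx xi c) = \sum_k c k ^+ 2 * dotv (xi k) (xi k).
Proof.
rewrite linear_sum; apply: eq_bigr => k _.
by rewrite linearZ/= mxtrace_outer.
Qed.

End frame_mx.

Section framed_exponential_maps.
Context {R : realType} {n N : nat}.
Variables (xi : 'I_N -> 'rV[R]_n) (U : 'M[R]_(N + N)).
Implicit Types p q : 'I_N -> R.

(* The map with complex coordinates [(p k + i q k) e^(2 pi i <xi k, u>)] in the
   frame given by the rows of [U]. *)
Definition framed_exp p q (u : 'rV[R]_n) : 'rV[R]_(N + N) :=
  row_mx (\row_k (p k * cos (phase (xi k) u) - q k * sin (phase (xi k) u)))
         (\row_k (q k * cos (phase (xi k) u) + p k * sin (phase (xi k) u)))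
  *m U.

Lemma framed_exp_trig p q : framed_exp p q =
  trig xi (fun k => p k *: row (lshift N k) U + q k *: row (rshift N k) U)
          (fun k => p k *: row (rshift N k) U - q k *: row (lshift N k) U).
Proof.
apply/funext => u; rewrite /framed_exp mulmx_sum_row big_split_ord/= /trig.
rewrite -big_split/=; apply: eq_bigr => k _.
by rewrite row_mxEl row_mxEr; apply/rowP => j; rewrite !mxE; ring.
Qed.

Lemma partial_framed_exp p q (i : 'I_n) :
  partial i (framed_exp p q) =
  framed_exp (fun k => - (phase (xi k) (delta_mx 0 i) * q k))
             (fun k => phase (xi k) (delta_mx 0 i) * p k).
Proof.
rewrite !framed_exp_trig /partial derive_trig; congr trig; apply/funext => k.
  by rewrite scalerBr !scalerA scaleNr addrC.
by rewrite scalerDr !scalerA scaleNr opprD addrC.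
Qed.

Lemma sum_partial2_framed_exp p q u :
  \sum_i partial i (partial i (framed_exp p q)) u =
  - (4 * pi ^+ 2) *: framed_exp (fun k => dotv (xi k) (xi k) * p k)
                                (fun k => dotv (xi k) (xi k) * q k) u.
Proof.
rewrite !framed_exp_trig sum_partial2_trig; congr (_ *: trig _ _ _ u).
  by apply/funext => k; rewrite scalerDr !scalerA.
by apply/funext => k; rewrite scalerBr !scalerA.
Qed.

Hypothesis U_orth : U *m U^T = 1%:M.

Lemma dotv_framed_exp p q p' q' u :
  dotv (framed_exp p q u) (framed_exp p' q' u) =
  \sum_k (p k * p' k + q k * q' k).
Proof.
rewrite /dotv trmx_mul mulmxA -[_ *m U *m _]mulmxA U_orth mulmx1.
rewrite tr_row_mx mul_row_col mxE [X in X + _]mxE [X in _ + X]mxE.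
rewrite -big_split/=; apply: eq_bigr => k _; rewrite !mxE.
rewrite -[RHS]mulr1 -(cos2Dsin2 (phase (xi k) u)); ring.
Qed.

End framed_exponential_maps.

Section exponential_immersions.
Context {R : realType} {n N : nat}.
Variables (xi : 'I_N -> 'rV[R]_n) (U : 'M[R]_(N + N)) (c : 'I_N -> R).
Hypothesis n_gt0 : (0 < n)%N.
Hypothesis U_orth : U *m U^T = 1%:M.

Let x u := exp_map xi c u *m U.

Let xE : x = framed_exp xi U c (fun=> 0).
Proof.
apply/funext => u; congr (row_mx _ _ *m U); apply/rowP => k;
  by rewrite !mxE mul0r ?subr0 ?add0r.
Qed.

Let n_neq0 : (n%:R : R) != 0.
Proof. by rewrite pnatr_eq0 -lt0n. Qed.

Lemma dotv_exp u : dotv (x u) (x u) = \sum_k c k ^+ 2.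
Proof. by rewrite xE dotv_framed_exp//; apply: eq_bigr => k _; ring. Qed.

Lemma first_fundamental_form_exp u :
  first_fundamental_form x u = (4 * pi ^+ 2) *: frame_mx xi c.
Proof.
apply/matrixP => i j; rewrite xE !mxE summxE !partial_framed_exp.
rewrite dotv_framed_exp// mulr_sumr; apply: eq_bigr => k _.
by rewrite !phase_delta !mxE big_ord1 !mxE; ring.
Qed.

Lemma first_fundamental_form_torus u :
  first_fundamental_form x u = torus_metric R n <->
  frame_mx xi c = n%:R^-1%:M.
Proof.
rewrite first_fundamental_form_exp /torus_metric -scale_scalar_mx.
split=> [|-> //]; apply: scalerI.
by rewrite mulf_neq0// sqrf_eq0 pi_neq0.
Qed.

Lemma isometric_immersion_exp (L : set 'rV[R]_n) :
  (forall k, dual_lattice L (xi k)) ->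
  isometric_immersion L (torus_metric R n) x <->
  frame_mx xi c = n%:R^-1%:M /\ \sum_k c k ^+ 2 = 1.
Proof.
move=> xiL; split=> [x_iso|[/first_fundamental_form_torus fff c_unit]].
  split.
    exact/(first_fundamental_form_torus 0)/(immersion_isometric x_iso).
  by rewrite -(dotv_exp 0); apply/enorm_eq1/(immersion_sphere x_iso).
have [a [b xab]] : exists a b, x = trig xi a b.
  by rewrite xE framed_exp_trig; do 2 eexists.
split=> [| |u|u|//].
- by rewrite xab; exact: smooth_trig.
- by rewrite xab; exact: periodic_trig.
- by apply/enorm_eq1; rewrite dotv_exp.
apply: row_free_jacobian; last rewrite fff /torus_metric.
  by rewrite xab; exact: differentiable_trig.
rewrite unitmxE det_scalar unitrX// unitfE.
by rewrite !mulf_neq0 ?invr_eq0 ?sqrf_eq0 ?pi_neq0.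
Qed.

Hypothesis frame_n : frame_mx xi c = n%:R^-1%:M.
Hypothesis c_unit : \sum_k c k ^+ 2 = 1.

Lemma sum_dotv_frame : \sum_k c k ^+ 2 * dotv (xi k) (xi k) = 1.
Proof.
by rewrite -mxtrace_frame_mx frame_n mxtrace_scalar -[_ *+ n]mulr_natr mulVf.
Qed.

Lemma mean_curvature_exp u (nu : 'rV[R]_(N + N)) :
  mean_curvature x u nu =
  - dotv (framed_exp xi U (fun k => dotv (xi k) (xi k) * c k) (fun=> 0) u) nu.
Proof.
have fff : first_fundamental_form x u = (4 * pi ^+ 2 / n%:R)%:M.
  exact/first_fundamental_form_torus.
rewrite (mean_curvature_scalar _ fff) xE sum_partial2_framed_exp.
rewrite [dotv _ _]linearZl_LR/=.
have -> : (fun k => dotv (xi k) (xi k) * 0) = (fun=> 0).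
  by apply/funext => k; rewrite mulr0.
have : 4 * pi ^+ 2 != 0 :> R by rewrite mulf_neq0// sqrf_eq0 pi_neq0.
move: (4 * _) (dotv _ _) n_neq0 => s d n0 s_neq0; field; exact/andP.
Qed.

(* With [y] proportional to the Laplacian of [x], [nu = x - y] is normal to [x]
   inside the sphere; minimality makes it orthogonal to [y], hence to itself. *)
Lemma minimal_exp_unit k :
  minimal x -> c k != 0 -> dotv (xi k) (xi k) = 1.
Proof.
move=> x_min ck_neq0.
pose l j := dotv (xi j) (xi j).
pose nu := framed_exp xi U (fun j => (1 - l j) * c j) (fun=> 0).
have xnu : dotv (x 0) (nu 0) = 0.
  rewrite xE dotv_framed_exp//.
  transitivity (\sum_j c j ^+ 2 - \sum_j c j ^+ 2 * l j).
    by rewrite -sumrB; apply: eq_bigr => j _; ring.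
  by rewrite c_unit sum_dotv_frame subrr.
have nu_normal : sphere_normal x 0 (nu 0).
  split=> // i; rewrite xE partial_framed_exp dotv_framed_exp//.
  by apply: big1 => j _; ring.
have := x_min 0 (nu 0) nu_normal; rewrite mean_curvature_exp.
set y := framed_exp _ _ _ _ _ => /eqP; rewrite oppr_eq0 => /eqP ynu.
have : \sum_j ((1 - l j) * c j) ^+ 2 = 0.
  transitivity (dotv (x 0) (nu 0) - dotv y (nu 0)); last first.
    by rewrite xnu ynu subrr.
  rewrite xE !dotv_framed_exp// -sumrB.
  by apply: eq_bigr => j _; rewrite /l; ring.
move=> /eqP; rewrite psumr_eq0 => [/allP/(_ k (mem_index_enum _))|j _];
  last exact: sqr_ge0.
by rewrite /= sqrf_eq0 mulf_eq0 (negbTE ck_neq0) orbF subr_eq0 => /eqP.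
Qed.

Lemma minimal_exp :
  minimal x <-> forall k, c k != 0 -> dotv (xi k) (xi k) = 1.
Proof.
split=> [x_min k|xi_unit u nu [xnu _]]; first exact: minimal_exp_unit.
rewrite mean_curvature_exp (_ : (fun k => _) = c); last first.
  apply/funext => k; have [->|/xi_unit ->] := eqVneq (c k) 0.
    by rewrite mulr0.
  by rewrite mul1r.
by rewrite -xE xnu oppr0.
Qed.

End exponential_immersions.

(** * Lattices, frames and critical points *)

Section lattices.
Context {R : realType} {n : nat}.
Implicit Types (L : set 'rV[R]_n) (B D : 'M[R]_n) (X : set 'rV[int]_n).

Lemma gram_unit D : (gram D \in unitmx) = (D \in unitmx).
Proof. by rewrite unitmx_mul unitmx_tr andbb. Qed.

Lemma invmx_gram D :
  D \in unitmx -> invmx (gram D) = (invmx D)^T *m invmx D.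
Proof.
move=> Du; have Gu : gram D \in unitmx by rewrite gram_unit.
rewrite -[RHS](mulKmx Gu) /gram trmx_inv -!mulmxA.
by rewrite [D^T *m _]mulmxA mulmxV ?unitmx_tr// mul1mx mulmxV// mulmx1.
Qed.

Lemma gram_invmx_tr B :
  B \in unitmx -> gram (invmx B^T) = invmx (gram B).
Proof. by move=> Bu; rewrite invmx_gram// /gram !trmx_inv trmxK. Qed.

Lemma congr_scalar_mx D (M : 'M[R]_n) (s : R) : D \in unitmx ->
  D^T *m M *m D = s%:M <-> M = s *: invmx (gram D).
Proof.
move=> Du; have DTu : D^T \in unitmx by rewrite unitmx_tr.
rewrite invmx_gram// trmx_inv; split=> [DMD|->].
  rewrite -[M](mulKmx DTu) -[_ *m M](mulmxK Du) DMD mul_scalar_mx.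
  by rewrite -scalemxAr.
by rewrite -scalemxAr -scalemxAl mulKVmx// mulVmx// scalemx1.
Qed.

Lemma lattice_basis_dual B L :
  lattice_basis B L -> lattice_basis (invmx B^T) (dual_lattice L).
Proof.
move=> [Bu LE]; have BTu : B^T \in unitmx by rewrite unitmx_tr.
split; first by rewrite unitmx_inv.
apply/seteqP; split=> [xi xiL|_ [a _ <-] v]; last first.
  rewrite LE => -[b _ <-]; rewrite /dotv trmx_mul mulmxA mulmxKV//.
  by rewrite mxE; apply: rpred_sum => i _; rewrite !mxE rpredM// intr_int.
have xi_int i : exists z : int, (xi *m B^T) 0 i = z%:~R.
  have /xiL/intrP[z zE] : L (row i B).
    rewrite LE; exists (delta_mx 0 i) => //.
    by rewrite rowE /zrow map_delta_mx.
  by exists z; rewrite -zE /dotv !mxE; apply: eq_bigr => j _; rewrite !mxE.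
have [z zE] := choice xi_int; exists (\row_i z i) => //.
rewrite -[RHS](mulmxK BTu); congr (_ *m _).
by apply/rowP => i; rewrite !mxE -zE mxE.
Qed.

Lemma C_psdef X : C_ R X `<=` psdef R n.
Proof. by apply: psdef_convex_hull => _ [a _ <-]; exact: psdef_outer. Qed.

Lemma C_frame_mx X (P : 'M[R]_n) : C_ R X P ->
  exists k (a : 'I_k -> 'rV[int]_n) (c : 'I_k -> R),
    [/\ forall i, X (a i), \sum_i c i ^+ 2 = 1
      & P = frame_mx (fun i => zrow R (a i)) c].
Proof.
move=> [k [t [s [t_ge0 t_sum1 Xs ->]]]].
have {}Xs i : exists a, X a /\ outer (zrow R a) = s i.
  by have [a] := Xs i; exists a.
have [a aP] := choice Xs; have sqrtK i : Num.sqrt (t i) ^+ 2 = t i.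
  by rewrite sqr_sqrtr.
exists k, a, (fun i => Num.sqrt (t i)); split=> [i||].
- by have [] := aP i.
- by under eq_bigr do rewrite sqrtK.
- by apply: eq_bigr => i _; have [_ ->] := aP i; rewrite sqrtK.
Qed.

Lemma critical_point_C X D :
  (0 < n)%N -> D \in unitmx ->
  C_ R X (n%:R^-1 *: invmx (gram D)) ->
  critical_point (fun M : 'M[R]_n => \det M) (C_ R X)
    (n%:R^-1 *: invmx (gram D)) <->
  forall a, X a -> dotv (zrow R a *m D) (zrow R a *m D) = 1.
Proof.
move=> n_gt0 Du PC; set P := n%:R^-1 *: _ in PC *.
have n_neq0 : (n%:R : R) != 0 by rewrite pnatr_eq0 -lt0n.
have Pu : P \in unitmx.
  by rewrite unitmxZ ?unitfE ?invr_eq0// unitmx_inv gram_unit.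
have trE a : \tr (invmx P *m outer (zrow R a)) =
    n%:R * dotv (zrow R a *m D) (zrow R a *m D).
  by rewrite invmxZ// invmxK invrK -scalemxAl mxtraceZ -quad_mxtrace quad_gram.
rewrite critical_point_det_hull//; last exact: convex_hull_sub_affine_hull.
split=> [tr_n a Xa|a_unit _ [a Xa <-]].
  by apply: (mulfI n_neq0); rewrite -trE mulr1; apply: tr_n; exists a.
by rewrite trE a_unit// mulr1.
Qed.

End lattices.

(** * Full minimal immersions and critical points of the determinant *)

Section full_minimal_immersion.
Context {R : realType} {n N : nat}.
Variables (L : set 'rV[R]_n) (D : 'M[R]_n) (Y : set 'rV[int]_n).
Variables (xi : 'I_N -> 'rV[R]_n) (c : 'I_N -> R) (U : 'M[R]_(N + N)).
Hypothesis n_gt0 : (0 < n)%N.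
Hypothesis dimE : has_dim (torus_eigenspace L (torus_metric R n) n%:R) (N + N).
Hypothesis DL : lattice_basis D (dual_lattice L).
Hypothesis Y_unit : unit_coordinates D Y.
Hypothesis xiL : forall k, dual_lattice L (xi k).
Hypothesis U_orth : U *m U^T = 1%:M.

Let x u := exp_map xi c u *m U.

Hypothesis x_iso : isometric_immersion L (torus_metric R n) x.
Hypothesis x_minimal : minimal x.
Hypothesis x_full : linearly_full x.

Let c_neq0 k : c k != 0.
Proof. by have [] := linearly_full_exp x_full. Qed.

Lemma full_minimal_unit k : dotv (xi k) (xi k) = 1.
Proof.
have [frame_n c_unit] := (isometric_immersion_exp c n_gt0 U_orth xiL).1 x_iso.
exact: (minimal_exp n_gt0 U_orth frame_n c_unit).1 x_minimal k (c_neq0 k).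
Qed.

Lemma full_minimal_generators (a : 'I_N -> 'rV[int]_n) :
  (forall k, zrow R (a k) *m D = xi k) ->
  [set outer (zrow R b) | b in Y] = range (fun k => outer (zrow R (a k))).
Proof.
move=> aE; have [Du DLE] := DL; have [Y_len Y_pm] := Y_unit.
have zrowN b : zrow R (- b) = - zrow R b by exact: map_mxN.
apply/seteqP; split => [_ [b Yb <-]|_ [k _ <-]].
  have bL : dual_lattice L (zrow R b *m D) by rewrite DLE; exists b.
  have /enorm_eq1 b_unit := Y_len b Yb.
  have [_ waves_full] := linearly_full_exp x_full.
  have [k] := full_unit_frequencies xiL full_minimal_unit dimE waves_full
    bL b_unit.
  rewrite -aE -mulNmx => bE; exists k => //.
  by case: bE => /(can_inj (mulmxK Du)) ->; rewrite ?outerN.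
have [|[Ya|Ya] _] := Y_pm (a k).
  by apply/enorm_eq1; rewrite aE full_minimal_unit.
  by exists (a k).
by exists (- a k); rewrite // zrowN outerN.
Qed.

Lemma full_minimal_critical :
  relative_interior (C_ R Y) (n%:R^-1 *: invmx (gram D)) /\
  critical_point (fun M : 'M[R]_n => \det M) (C_ R Y)
    (n%:R^-1 *: invmx (gram D)).
Proof.
have [Du DLE] := DL; have [Y_len _] := Y_unit.
have xi_coord k : exists a, zrow R a *m D = xi k.
  by have := xiL k; rewrite DLE => -[a _ <-]; exists a.
have [a aE] := choice xi_coord.
have [frame_n c_unit] := (isometric_immersion_exp c n_gt0 U_orth xiL).1 x_iso.
have PE : n%:R^-1 *: invmx (gram D) = frame_mx (fun k => zrow R (a k)) c.
  symmetry; apply/congr_scalar_mx => //.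
  by rewrite -frame_mx_mulmx -frame_n; congr frame_mx; apply/funext.
have P_int : relative_interior (C_ R Y) (n%:R^-1 *: invmx (gram D)).
  rewrite PE /C_ (full_minimal_generators aE).
  apply: relative_interior_pos => // k.
  by rewrite exprn_even_gt0//= c_neq0.
split=> //; apply/critical_point_C => //; first by have [] := P_int.
by move=> b Yb; apply/enorm_eq1/Y_len.
Qed.

End full_minimal_immersion.

Lemma critical_minimal_immersion (R : realType) (n : nat) (X : set 'rV[int]_n)
    (L : set 'rV[R]_n) (D : 'M[R]_n) :
  (0 < n)%N -> lattice_basis D (dual_lattice L) ->
  C_ R X (n%:R^-1 *: invmx (gram D)) ->
  critical_point (fun M : 'M[R]_n => \det M) (C_ R X)
    (n%:R^-1 *: invmx (gram D)) ->
  exists (N : nat) (x : 'rV[R]_n -> 'rV[R]_(N + N)),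
    isometric_immersion L (torus_metric R n) x /\ minimal x.
Proof.
move=> n_gt0 [Du DLE] PX crit; have [k [a [c [Xa c_unit PE]]]] := C_frame_mx PX.
pose xi i := zrow R (a i) *m D.
have xiL i : dual_lattice L (xi i) by rewrite DLE; exists (a i).
have frame_n : frame_mx xi c = n%:R^-1%:M.
  by rewrite frame_mx_mulmx; apply/congr_scalar_mx.
have U_orth : (1%:M : 'M[R]_(k + k)) *m 1%:M^T = 1%:M by rewrite trmx1 mulmx1.
exists k, (fun u => exp_map xi c u *m 1%:M); split.
  exact/isometric_immersion_exp.
apply/minimal_exp => // i _.
exact: (critical_point_C n_gt0 Du PX).1 crit (a i) (Xa i).
Qed.

Theorem theorem3p6 (R : realType) (n : nat) (n_gt0 : (0 < n)%N) :
  (forall (N : nat) (L : set 'rV[R]_n) (x : 'rV[R]_n -> 'rV[R]_(N + N))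
      (D : 'M[R]_n) (Y : set 'rV[int]_n),
    is_lattice L ->
    has_dim (torus_eigenspace L (torus_metric R n) n%:R) (N + N) ->
    isometric_immersion L (torus_metric R n) x ->
    homogeneous L x ->
    lattice_basis D (dual_lattice L) ->
    unit_coordinates D Y ->
    minimal x ->
    linearly_full x ->
    relative_interior (C_ R Y) (n%:R^-1 *: invmx (gram D)) /\
    critical_point (fun M : 'M[R]_n => \det M) (C_ R Y)
      (n%:R^-1 *: invmx (gram D)))
  /\
  (forall (X : set 'rV[int]_n) (P : 'M[R]_n),
    finite_set X ->
    C_ R X `&` posdef R n !=set0 ->
    relative_interior (C_ R X) P ->
    critical_point (fun M : 'M[R]_n => \det M) (C_ R X) P ->
    (exists (L : set 'rV[R]_n) (B : 'M[R]_n),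
      lattice_basis B L /\ gram B = n%:R *: P) /\
    (forall (L : set 'rV[R]_n) (B : 'M[R]_n),
      lattice_basis B L -> gram B = n%:R *: P ->
      exists (N : nat) (x : 'rV[R]_n -> 'rV[R]_(N + N)),
        isometric_immersion L (torus_metric R n) x /\ minimal x)).
Proof.
split=> [N L x D Y _ dimE x_iso [xi [c [U [xiL _ U_orth xE]]]] DL Y_unit|].
  have {}xE : x = fun u => exp_map xi c u *m U by exact/funext.
  rewrite {}xE in x_iso * => x_minimal x_full.
  exact: full_minimal_critical xiL U_orth x_iso x_minimal x_full.
move=> X P _ CX P_int crit; have [PX _] := P_int.
have [Psym Ppos] := relative_interior_posdef (@C_psdef R n X) CX P_int.
split=> [|L B BL GE].
  have [|B Bu GE] := @cholesky R n (n%:R *: P).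
    split=> [|v v_neq0]; first by rewrite linearZ/= Psym.
    by rewrite -scalemxAr -scalemxAl mxE mulr_gt0 ?ltr0n ?Ppos.
  by exists [set zrow R a *m B | a in [set: 'rV[int]_n]], B.
have PE : P = n%:R^-1 *: invmx (gram (invmx B^T)).
  rewrite gram_invmx_tr ?BL.1// invmxK GE scalerA mulVf ?scale1r//.
  by rewrite pnatr_eq0 -lt0n.
rewrite PE in PX crit.
exact: critical_minimal_immersion (lattice_basis_dual BL) PX crit.
Qed.
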